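(* Let $X$ be a complex Banach space, let $E \subset X'$ be a closed, almost norming vector subspace of the dual space $X'$, and let $T$ be a bounded linear operator on $X$. Let $\Phi$ be an at most countable set of non-decreasing functions $\varphi: [0,\infty) \to [0,\infty)$ which are strictly positive on $(0,\infty)$. If for each $x \in X$ and each $x' \in E$ satisfying $\|x\| \le 1$ and $\|x'\| \le 1$ there is a function $\varphi \in \Phi$ such that $$\sum_{n=0}^\infty \varphi(|\langle x', T^n x\rangle|) < \infty,$$ then the spectral radius of $T$ satisfies $r(T) < 1$.
   Context: $X'$ is the space of all bounded linear functionals on $X$. A vector subspace $E \subset X'$ is called almost norming if there is a constant $C > 0$ such that $\|x\| \le \sup_{x' \in E,\, \|x'\| \le 1} C\,|\langle x', x\rangle|$ for all $x \in X$. *)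

(* Defs.v *)
From Stdlib Require Import Reals Lra FunctionalExtensionality ProofIrrelevance.
From Coquelicot Require Import Coquelicot.

Open Scope R_scope.

(* Coquelicot's [is_linear] includes boundedness, so [bounded_linear U V] consists of the
   bounded linear maps from U to V. *)
Record bounded_linear (U V : NormedModule C_AbsRing) : Type := BoundedLinear
  { bl_fun :> U -> V;
    bl_linear : is_linear bl_fun }.

Arguments BoundedLinear {U V} bl_fun bl_linear.
Arguments bl_fun {U V} _ _.
Arguments bl_linear {U V} _.

Lemma bl_ext {U V : NormedModule C_AbsRing} (f g : bounded_linear U V) :
  (forall x, f x = g x) -> f = g.
Proof.
destruct f as [f hf]; destruct g as [g hg]; simpl; intros H.
assert (E : f = g) by (apply functional_extensionality; exact H).
subst g; f_equal; apply proof_irrelevance.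
Qed.

Lemma norm_scal_C {V : NormedModule C_AbsRing} (k : C) (x : V) :
  norm (scal k x) = Cmod k * norm x.
Proof.
apply Rle_antisym; [exact (norm_scal (K := C_AbsRing) k x)|].
destruct (Ceq_dec k 0) as [->|hk].
- rewrite Cmod_0, Rmult_0_l; apply norm_ge_0.
- assert (E : x = scal (/ k)%C (scal k x)).
  { assert (h : mult (/ k)%C k = @one C_Ring) by exact (Cinv_l k hk).
    rewrite scal_assoc, h; symmetry; exact (scal_one x). }
  pose proof (norm_scal (K := C_AbsRing) (/ k)%C (scal k x)) as H.
  change (norm (scal (/ k)%C (scal k x)) <= Cmod (/ k)%C * norm (scal k x)) in H.
  rewrite <- E in H.
  rewrite (Cmod_inv k hk) in H.
  apply Rmult_le_compat_l with (r := Cmod k) in H; [|apply Cmod_ge_0].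
  rewrite <- Rmult_assoc, Rinv_r, Rmult_1_l in H; [exact H|].
  now intros h; apply hk, Cmod_eq_0.
Qed.

Section Operations.
Context {U V : NormedModule C_AbsRing}.
Implicit Types f g : bounded_linear U V.

Lemma bl_plus_linear f g : is_linear (fun x => plus (f x) (g x)).
Proof.
exact (is_linear_comp (fun x => (f x, g x)) (fun t => plus (fst t) (snd t))
  (is_linear_prod _ _ (bl_linear f) (bl_linear g)) is_linear_plus).
Qed.

Lemma bl_opp_linear f : is_linear (fun x => opp (f x)).
Proof. exact (is_linear_comp f opp (bl_linear f) is_linear_opp). Qed.

Lemma bl_scal_linear (k : C) f : is_linear (fun x => scal k (f x)).
Proof.
exact (is_linear_comp f (fun y => scal (k : C_AbsRing) y) (bl_linear f)
  (is_linear_scal_r (k : C_AbsRing) Cmult_comm)).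
Qed.

Definition bl_zero : bounded_linear U V := BoundedLinear (fun _ => zero) is_linear_zero.
Definition bl_plus f g : bounded_linear U V := BoundedLinear _ (bl_plus_linear f g).
Definition bl_opp f : bounded_linear U V := BoundedLinear _ (bl_opp_linear f).
Definition bl_scal (k : C) f : bounded_linear U V := BoundedLinear _ (bl_scal_linear k f).

(* The supremum is finite for every element of [bounded_linear U V] (see [op_norm_lub]), so
   the projection [real] loses nothing. *)
Definition op_norm f : R :=
  real (Lub_Rbar (fun r => exists x : U, norm x <= 1 /\ r = norm (f x))).

Lemma op_norm_lub f :
  is_lub_Rbar (fun r => exists x : U, norm x <= 1 /\ r = norm (f x)) (op_norm f).
Proof.
unfold op_norm; set (A := fun r => _).
pose proof (Lub_Rbar_correct A) as [H1 H2].
destruct (linear_norm _ (bl_linear f)) as [M [hM HM]].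
assert (h0 : Rbar_le 0 (Lub_Rbar A)).
{ apply H1; exists zero; rewrite (linear_zero _ (bl_linear f)), !norm_zero.
  split; [lra|reflexivity]. }
assert (h1 : Rbar_le (Lub_Rbar A) M).
{ apply H2; intros r [x [hx ->]]; simpl.
  apply Rle_trans with (1 := HM x).
  rewrite <- (Rmult_1_r M) at 2; apply Rmult_le_compat_l; lra. }
destruct (Lub_Rbar A) as [l| |] eqn:E; simpl in *; try easy.
Qed.

Lemma op_norm_ub f (x : U) : norm x <= 1 -> norm (f x) <= op_norm f.
Proof.
intros hx; apply (proj1 (op_norm_lub f) (norm (f x))).
now exists x; split.
Qed.

Lemma op_norm_least f (M : R) :
  (forall x, norm x <= 1 -> norm (f x) <= M) -> op_norm f <= M.
Proof.
intros H; apply (proj2 (op_norm_lub f) M).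
intros r [x [hx ->]]; exact (H x hx).
Qed.

Lemma op_norm_plus f g : op_norm (bl_plus f g) <= op_norm f + op_norm g.
Proof.
apply op_norm_least; intros x hx; simpl.
apply Rle_trans with (1 := norm_triangle _ _).
apply Rplus_le_compat; now apply op_norm_ub.
Qed.

Lemma op_norm_scal (k : C) f : op_norm (bl_scal k f) <= Cmod k * op_norm f.
Proof.
apply op_norm_least; intros x hx; simpl.
apply Rle_trans with (1 := norm_scal (K := C_AbsRing) k (f x)).
apply Rmult_le_compat_l; [apply Cmod_ge_0|now apply op_norm_ub].
Qed.

Lemma op_norm_eq_0 f : op_norm f = 0 -> f = bl_zero.
Proof.
intros H; apply bl_ext; intros x; simpl.
apply (norm_eq_zero (K := C_AbsRing)).
pose proof (norm_ge_0 x) as hx.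
set (k := RtoC (/ (norm x + 1))).
assert (hk : Cmod k = / (norm x + 1)).
{ unfold k; rewrite Cmod_R, Rabs_pos_eq; [reflexivity|].
  apply Rlt_le, Rinv_0_lt_compat; lra. }
assert (h : norm (f (scal k x)) <= 0).
{ rewrite <- H; apply op_norm_ub; rewrite norm_scal_C, hk.
  apply Rmult_le_reg_l with (norm x + 1); [lra|].
  rewrite <- Rmult_assoc, Rinv_r; lra. }
rewrite (linear_scal _ (bl_linear f)), norm_scal_C, hk in h.
apply Rle_antisym; [|apply norm_ge_0].
apply Rmult_le_reg_l with (/ (norm x + 1)); [apply Rinv_0_lt_compat; lra|lra].
Qed.

Definition bl_AbelianMonoid_mixin : AbelianMonoid.mixin_of (bounded_linear U V).
Proof.
apply (AbelianMonoid.Mixin _ bl_plus bl_zero);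
  intros; apply bl_ext; intros; simpl.
- apply plus_comm.
- apply plus_assoc.
- apply plus_zero_r.
Defined.

Canonical bl_AbelianMonoid :=
  AbelianMonoid.Pack (bounded_linear U V) bl_AbelianMonoid_mixin (bounded_linear U V).

Definition bl_AbelianGroup_mixin : AbelianGroup.mixin_of bl_AbelianMonoid.
Proof.
apply (AbelianGroup.Mixin bl_AbelianMonoid bl_opp).
intros f; apply bl_ext; intros x; exact (plus_opp_r (f x)).
Defined.

Canonical bl_AbelianGroup :=
  AbelianGroup.Pack (bounded_linear U V) (AbelianGroup.Class _ _ bl_AbelianGroup_mixin)
    (bounded_linear U V).

Definition bl_ModuleSpace_mixin :
  ModuleSpace.mixin_of C_Ring bl_AbelianGroup.
Proof.
apply (ModuleSpace.Mixin C_Ring bl_AbelianGroup bl_scal);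
  intros; apply bl_ext; intros t.
- exact (scal_assoc x y (u t)).
- exact (scal_one (u t)).
- exact (scal_distr_l x (u t) (v t)).
- exact (scal_distr_r x y (u t)).
Defined.

Canonical bl_ModuleSpace :=
  ModuleSpace.Pack C_Ring (bounded_linear U V)
    (ModuleSpace.Class C_Ring _ _ bl_ModuleSpace_mixin) (bounded_linear U V).

Definition bl_ball f (eps : R) g : Prop := op_norm (minus g f) < eps.

Lemma op_norm_zero : op_norm bl_zero = 0.
Proof.
apply Rle_antisym.
- apply op_norm_least; intros x _; simpl; rewrite norm_zero; lra.
- rewrite <- (norm_zero (V := V)).
  apply (op_norm_ub bl_zero zero); rewrite norm_zero; lra.
Qed.

Lemma op_norm_opp f : op_norm (bl_opp f) = op_norm f.
Proof.
assert (H : forall h, op_norm (bl_opp h) <= op_norm h).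
{ intros h; apply op_norm_least; intros x hx; simpl.
  rewrite norm_opp; now apply op_norm_ub. }
apply Rle_antisym; [apply H|].
rewrite <- (opp_opp f) at 1; exact (H (bl_opp f)).
Qed.

Definition bl_UniformSpace_mixin : UniformSpace.mixin_of (bounded_linear U V).
Proof.
apply (UniformSpace.Mixin _ bl_zero bl_ball); unfold bl_ball.
- intros f e; rewrite minus_eq_zero.
  change (op_norm bl_zero < e); rewrite op_norm_zero; apply cond_pos.
- intros f g e; rewrite <- (opp_minus g f).
  change (opp (minus g f)) with (bl_opp (minus g f)); now rewrite op_norm_opp.
- intros f g h e1 e2 h1 h2.
  rewrite (minus_trans g h f).
  apply Rle_lt_trans with (1 := op_norm_plus _ _); lra.
Defined.

Canonical bl_UniformSpace :=
  UniformSpace.Pack (bounded_linear U V) bl_UniformSpace_mixin (bounded_linear U V).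

Canonical bl_NormedModuleAux :=
  NormedModuleAux.Pack C_AbsRing (bounded_linear U V)
    (NormedModuleAux.Class C_AbsRing _ (ModuleSpace.class C_Ring bl_ModuleSpace)
       bl_UniformSpace_mixin)
    (bounded_linear U V).

Definition bl_NormedModule_mixin :
  NormedModule.mixin_of C_AbsRing bl_NormedModuleAux.
Proof.
apply (NormedModule.Mixin C_AbsRing bl_NormedModuleAux op_norm 1).
- exact op_norm_plus.
- exact op_norm_scal.
- intros f g eps H; exact H.
- intros f g eps H; rewrite Rmult_1_l; exact H.
- exact op_norm_eq_0.
Defined.

Canonical bl_NormedModule :=
  NormedModule.Pack C_AbsRing (bounded_linear U V)
    (NormedModule.Class C_AbsRing _ _ bl_NormedModule_mixin) (bounded_linear U V).

End Operations.

Notation dual X := (bounded_linear X C_NormedModule).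

Definition is_subspace {V : ModuleSpace C_Ring} (E : V -> Prop) : Prop :=
  E zero /\
  (forall u v, E u -> E v -> E (plus u v)) /\
  (forall (k : C) u, E u -> E (scal k u)).

Definition almost_norming {X : NormedModule C_AbsRing} (E : dual X -> Prop) :
  Prop :=
  exists c : R, 0 < c /\
    forall x : X,
      Rbar_le (norm x)
        (Lub_Rbar (fun r => exists x' : dual X,
           E x' /\ norm x' <= 1 /\ r = c * Cmod (x' x))).

Definition resolvent_set {X : NormedModule C_AbsRing} (T : bounded_linear X X) (l : C) :
  Prop :=
  exists S : bounded_linear X X,
    (forall x, S (minus (scal l x) (T x)) = x) /\
    (forall x, minus (scal l (S x)) (T (S x)) = x).

Definition spectrum {X : NormedModule C_AbsRing} (T : bounded_linear X X) (l : C) : Prop :=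
  ~ resolvent_set T l.

(* On the zero space the spectrum is empty and the supremum is [m_infty]. *)
Definition spectral_radius {X : NormedModule C_AbsRing} (T : bounded_linear X X) : Rbar :=
  Lub_Rbar (fun r => exists l : C, spectrum T l /\ r = Cmod l).

Definition at_most_countable {A : Type} (P : A -> Prop) : Prop :=
  exists f : A -> nat, forall a b, P a -> P b -> f a = f b -> a = b.

(* Functions [0,oo) -> [0,oo) are represented by total functions R -> R whose
   values at negative arguments are irrelevant. *)
Definition nonneg_valued (phi : R -> R) : Prop :=
  forall t, 0 <= t -> 0 <= phi t.

Definition nondecreasing (phi : R -> R) : Prop :=
  forall s t, 0 <= s -> s <= t -> phi s <= phi t.

Definition strictly_positive (phi : R -> R) : Prop :=
  forall t, 0 < t -> 0 < phi t.

(* Main.v *)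
(* Suppose r = r(T) >= 1. Spectral points l with |l| close to r are approached by points mu with
   |mu| > r, which lie in the resolvent set, and the resolvent norm at mu is at least 1 / |mu - l|;
   this gives unit vectors x with T x close to mu x. As |mu| > 1 and E is almost norming, for every N
   there are x and x' in the unit balls with |<x', T^n x>| >= kappa for all n < N, where kappa > 0
   does not depend on N.
   On the other hand X * E is the union of countably many sets on which the series is bounded, for
   one fixed phi in Phi after rescaling its argument. By Baire's theorem one of them is dense in a
   ball. The value <x', T^n x> is a combination of the values of the form at four points of this
   ball, so that phi of a fixed positive number is bounded, for each n < N, by a sum of four terms
   of series with bounded sums. For large N this is a contradiction. *)
Require Import Defs.
From Stdlib Require Import Reals Lra Lia Classical IndefiniteDescription.
From Stdlib Require Cantor.
From Coquelicot Require Import Coquelicot.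
Open Scope R_scope.

(** * Complete distances and Baire's theorem *)

(* Completeness of a space [X] is carried below as the hypothesis [complete_dist] on a plain
   [NormedModule]: Coquelicot's [CompleteNormedModule] reaches the group operations by a second
   coercion path, convertible to but not syntactically equal to the first. *)
Definition complete_dist {P : Type} (d : P -> P -> R) : Prop :=
  forall u : nat -> P,
  (forall eps, 0 < eps ->
     exists N, forall n m, (N <= n)%nat -> (N <= m)%nat -> d (u n) (u m) < eps) ->
  exists l, forall eps, 0 < eps ->
    exists N, forall n, (N <= n)%nat -> d (u n) l < eps.

(* Somewhere density instead of interior points allows the sets [G k] not to be closed; here the
   sublevel sets of the series are not, since the functions in [Phi] may jump. *)
Lemma baire_somewhere_dense {P : Type} (d : P -> P -> R)
  (d_refl : forall p, d p p = 0)
  (d_sym : forall p q, d p q = d q p)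
  (d_triangle : forall p q r, d p r <= d p q + d q r)
  (d_complete : complete_dist d)
  (G : nat -> P -> Prop) (cover : forall p, exists k, G k p) (p0 : P) :
  exists k p e, 0 < e /\
    forall q, d p q < e -> forall eta, 0 < eta -> exists z, G k z /\ d q z < eta.
Proof.
apply NNPP; intros H.
set (step := fun (s t : nat * (P * posreal)) =>
  fst t = S (fst s) /\ snd (snd t) <= snd (snd s) / 2 /\
  forall z, d (fst (snd t)) z <= snd (snd t) ->
    d (fst (snd s)) z <= snd (snd s) /\ ~ G (fst s) z).
assert (Hstep : forall s, exists t, step s t).
{ intros [k [p e]].
  pose proof (cond_pos e) as he.
  apply NNPP; intros H1; apply H; exists k, p, (e / 2); split; [lra|].
  intros q hq eta heta; apply NNPP; intros H2; apply H1.
  assert (hr : 0 < Rmin (e / 2) (eta / 2)) by (apply Rmin_pos; lra).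
  pose proof (Rmin_l (e / 2) (eta / 2)); pose proof (Rmin_r (e / 2) (eta / 2)).
  exists (S k, (q, mkposreal _ hr)); unfold step; simpl.
  split; [reflexivity|split; [lra|]].
  intros z hz; split.
  - pose proof (d_triangle p q z); lra.
  - intros hG; apply H2; exists z; split; [exact hG|lra]. }
destruct (functional_choice step Hstep) as [F HF].
set (s := fun n => Nat.iter n F (0%nat, (p0, mkposreal 1 Rlt_0_1))).
assert (Hs : forall n, step (s n) (s (S n))) by (intros n; apply HF).
set (c := fun n => fst (snd (s n))).
set (r := fun n => pos (snd (snd (s n)))).
assert (Hidx : forall n, fst (s n) = n).
{ induction n as [|n IH]; [reflexivity|].
  rewrite (proj1 (Hs n)), IH; reflexivity. }
assert (Hr0 : forall n, 0 < r n) by (intros n; apply cond_pos).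
assert (Hr : forall n, r n <= (/ 2) ^ n).
{ induction n as [|n IH]; [unfold r; simpl; lra|].
  pose proof (proj1 (proj2 (Hs n))) as h.
  change (r (S n) <= r n / 2) in h; simpl; lra. }
assert (Hnest : forall n k z, d (c (n + k)%nat) z <= r (n + k)%nat -> d (c n) z <= r n).
{ intros n k; induction k as [|k IH]; intros z hz.
  - now rewrite Nat.add_0_r in hz.
  - apply IH; rewrite Nat.add_succ_r in hz.
    exact (proj1 (proj2 (proj2 (Hs (n + k)%nat)) z hz)). }
assert (Hc : forall n m, (n <= m)%nat -> d (c n) (c m) <= r n).
{ intros n m hnm; apply Hnest with (m - n)%nat.
  replace (n + (m - n))%nat with m by lia.
  rewrite d_refl; apply Rlt_le, Hr0. }
assert (Hr_small : forall eps, 0 < eps -> exists N, r N < eps).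
{ intros eps heps.
  destruct (pow_lt_1_zero (/ 2)) with (y := eps) as [N HN]; [|exact heps|].
  - rewrite Rabs_pos_eq; lra.
  - exists N; specialize (HN N (le_n N)).
    rewrite Rabs_pos_eq in HN by (apply pow_le; lra).
    apply Rle_lt_trans with (1 := Hr N) (2 := HN). }
destruct (d_complete c) as [l Hl].
{ intros eps heps; destruct (Hr_small (eps / 2)) as [N HN]; [lra|].
  exists N; intros n m hn hm.
  pose proof (d_triangle (c n) (c N) (c m)) as h.
  rewrite (d_sym (c n) (c N)) in h.
  pose proof (Hc N n hn); pose proof (Hc N m hm); lra. }
assert (Hcl : forall n, d (c n) l <= r n).
{ intros n; apply Rle_plus_epsilon; intros eps heps.
  destruct (Hl eps heps) as [N HN].
  pose proof (d_triangle (c n) (c (Nat.max n N)) l) as h.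
  specialize (HN (Nat.max n N) (Nat.le_max_r n N)).
  pose proof (Hc n (Nat.max n N) (Nat.le_max_l n N)); lra. }
destruct (cover l) as [k Hk].
pose proof (proj2 (proj2 (proj2 (Hs k)) l (Hcl (S k)))) as h.
apply h; rewrite Hidx; exact Hk.
Qed.

Lemma complete_norm {K : AbsRing} (V : CompleteNormedModule K) :
  complete_dist (fun x y : V => norm (minus x y)).
Proof.
intros u Hu.
assert (Hc : exists y : V, filterlim u eventually (locally y)).
{ apply (proj1 (filterlim_locally_cauchy (U := CompleteNormedModule.CompleteSpace K V)
    (F := eventually) u)); intros eps.
  destruct (Hu eps (cond_pos eps)) as [N HN].
  exists (fun n => (N <= n)%nat); split; [now exists N|].
  intros n m hn hm; apply (norm_compat1 (V := V)); now apply HN. }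
destruct Hc as [l Hl]; exists l; intros eps heps.
apply (proj1 (filterlim_locally_ball_norm (U := V) u l)) with (eps := mkposreal eps heps) in Hl.
exact Hl.
Qed.

(** * Bounded operators and resolvents *)

Lemma norm_minus_sym {K : AbsRing} {V : NormedModule K} (x y : V) :
  norm (minus x y) = norm (minus y x).
Proof. now rewrite <- opp_minus, norm_opp. Qed.

Lemma norm_minus_triangle {K : AbsRing} {V : NormedModule K} (x y z : V) :
  norm (minus x z) <= norm (minus x y) + norm (minus y z).
Proof. rewrite (minus_trans y); apply norm_triangle. Qed.

Lemma op_norm_ge_0 {U V : NormedModule C_AbsRing} (f : bounded_linear U V) :
  0 <= op_norm f.
Proof. exact (norm_ge_0 (V := @bl_NormedModule U V) f). Qed.

Lemma op_norm_bound {U V : NormedModule C_AbsRing} (f : bounded_linear U V) (x : U) :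
  norm (f x) <= op_norm f * norm x.
Proof.
destruct (Req_dec (norm x) 0) as [h0|h0].
- rewrite (norm_eq_zero (K := C_AbsRing) x h0), (linear_zero _ (bl_linear f)).
  rewrite !norm_zero; lra.
- pose proof (norm_ge_0 x) as hx.
  assert (hk : Cmod (RtoC (/ norm x)) = / norm x).
  { rewrite Cmod_R, Rabs_pos_eq; [reflexivity|].
    apply Rlt_le, Rinv_0_lt_compat; lra. }
  assert (h : norm (f (scal (RtoC (/ norm x)) x)) <= op_norm f).
  { apply op_norm_ub; rewrite norm_scal_C, hk, Rinv_l; [lra|exact h0]. }
  rewrite (linear_scal _ (bl_linear f)), norm_scal_C, hk in h.
  apply Rmult_le_compat_l with (r := norm x) in h; [|exact hx].
  rewrite <- Rmult_assoc, Rinv_r in h by exact h0; lra.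
Qed.

Lemma is_linear_iter {V : NormedModule C_AbsRing} (T : bounded_linear V V) (n : nat) :
  is_linear (fun x : V => Nat.iter n T x).
Proof.
induction n as [|n IH]; simpl.
- exact is_linear_id.
- exact (is_linear_comp _ _ IH (bl_linear T)).
Qed.

Lemma norm_iter_le {V : NormedModule C_AbsRing} (T : bounded_linear V V) (n : nat) (x : V) :
  norm (Nat.iter n T x) <= op_norm T ^ n * norm x.
Proof.
induction n as [|n IH]; simpl; [lra|].
apply Rle_trans with (1 := op_norm_bound T _).
rewrite Rmult_assoc; apply Rmult_le_compat_l; [apply op_norm_ge_0|exact IH].
Qed.

Lemma minus_plus_plus {G : AbelianGroup} (a b c d : G) :
  minus (plus a b) (plus c d) = plus (minus a c) (minus b d).
Proof.
unfold minus; rewrite opp_plus, <- !plus_assoc; f_equal.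
rewrite !plus_assoc; f_equal; apply plus_comm.
Qed.

Lemma plus_minus_cancel {G : AbelianGroup} (a b : G) : minus (plus a b) b = a.
Proof.
unfold minus; rewrite <- plus_assoc.
exact (eq_trans (f_equal (plus a) (plus_opp_r b)) (plus_zero_r a)).
Qed.

Lemma minus_minus_minus {G : AbelianGroup} (a b c : G) :
  minus (minus a b) (minus a c) = minus c b.
Proof.
rewrite (minus_trans a c b), <- (opp_minus a c); apply plus_comm.
Qed.

Lemma scal_minus_shift {V : ModuleSpace C_Ring} (l mu : C) (x t : V) :
  minus (scal l x) t = minus (minus (scal mu x) t) (scal (mu - l)%C x).
Proof.
change (mu - l)%C with (minus (G := C_Ring) mu l).
rewrite scal_minus_distr_r; symmetry; exact (minus_minus_minus _ _ _).
Qed.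

Lemma scal_inv_l {V : ModuleSpace C_Ring} (k : C) (x : V) :
  k <> 0%C -> scal (/ k)%C (scal k x) = x.
Proof.
intros hk; rewrite scal_assoc; change (mult (/ k)%C k) with (/ k * k)%C.
rewrite Cinv_l by exact hk; exact (scal_one x).
Qed.

Lemma scal_inv_r {V : ModuleSpace C_Ring} (k : C) (x : V) :
  k <> 0%C -> scal k (scal (/ k)%C x) = x.
Proof.
intros hk; rewrite scal_assoc; change (mult k (/ k)%C) with (k * / k)%C.
rewrite Cinv_r by exact hk; exact (scal_one x).
Qed.

Lemma scal_minus_factor {V : ModuleSpace C_Ring} (k : C) (x y : V) :
  k <> 0%C -> minus (scal k x) y = scal k (minus x (scal (/ k)%C y)).
Proof. intros hk; now rewrite scal_minus_distr_l, scal_inv_r. Qed.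

Lemma scal_comm_minus {V : ModuleSpace C_Ring} (k l : C) (x y : V) :
  minus (scal l (scal k x)) (scal k y) = scal k (minus (scal l x) y).
Proof.
rewrite scal_minus_distr_l, !scal_assoc.
f_equal; f_equal; exact (Cmult_comm l k).
Qed.

Lemma norm_minus_diag {K : AbsRing} {V : NormedModule K} (x : V) : norm (minus x x) = 0.
Proof.
refine (eq_ind_r (fun v => norm v = 0) _ (minus_eq_zero x)); apply (norm_zero (V := V)).
Qed.

Lemma norm_minus_plus_le {K : AbsRing} {V : NormedModule K} (a b c d : V) :
  norm (minus (plus a b) (plus c d)) <= norm (minus a c) + norm (minus b d).
Proof.
refine (eq_ind_r (fun v => norm v <= _) _ (minus_plus_plus a b c d)).
apply (norm_triangle (V := V)).
Qed.

Lemma norm_scal_minus {V : NormedModule C_AbsRing} (k : C) (x y : V) :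
  norm (minus (scal k x) (scal k y)) = Cmod k * norm (minus x y).
Proof.
transitivity (norm (scal k (minus x y))); [|apply norm_scal_C].
f_equal; symmetry; exact (scal_minus_distr_l (K := C_Ring) k x y).
Qed.

Lemma norm_minus_small_eq {K : AbsRing} {V : NormedModule K} (x y : V) :
  (forall eps, 0 < eps -> norm (minus x y) <= eps) -> x = y.
Proof.
intros h; apply NNPP; intros hne.
pose proof (norm_minus_gt_0 x y hne) as hp.
specialize (h (norm (minus x y) / 2)); lra.
Qed.

Lemma complete_op_norm {U V : NormedModule C_AbsRing} :
  complete_dist (fun x y : V => norm (minus x y)) ->
  complete_dist (fun f g : bounded_linear U V => op_norm (minus f g)).
Proof.
intros HV u Hu; cbv beta in Hu.
assert (Hpt : forall x : U, exists l : V, forall eps, 0 < eps ->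
    exists N, forall n, (N <= n)%nat -> norm (minus (u n x) l) < eps).
{ intros x; apply HV; intros eps heps.
  pose proof (norm_ge_0 x) as hx.
  destruct (Hu (eps / (norm x + 1))) as [N HN]; [apply Rdiv_lt_0_compat; lra|].
  exists N; intros n m hn hm.
  pose proof (op_norm_bound (minus (u n) (u m)) x) as h1.
  change (norm (minus (u n x) (u m x)) <= op_norm (minus (u n) (u m)) * norm x) in h1.
  specialize (HN n m hn hm).
  apply Rle_lt_trans with (1 := h1).
  apply Rle_lt_trans with (eps / (norm x + 1) * norm x).
  { apply Rmult_le_compat_r; lra. }
  apply Rmult_lt_reg_r with (norm x + 1); [lra|].
  field_simplify; nra. }
destruct (functional_choice _ Hpt) as [L HL].
assert (Hclose : forall eps, 0 < eps -> exists N, forall n, (N <= n)%nat ->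
    forall x, norm (minus (u n x) (L x)) <= eps * norm x).
{ intros eps heps; destruct (Hu eps heps) as [N HN]; exists N; intros n hn x.
  apply Rle_plus_epsilon; intros eta heta.
  destruct (HL x eta heta) as [N' HN'].
  specialize (HN' (Nat.max N N') (Nat.le_max_r _ _)).
  specialize (HN n (Nat.max N N') hn (Nat.le_max_l _ _)).
  pose proof (op_norm_bound (minus (u n) (u (Nat.max N N'))) x) as h1.
  change (norm (minus (u n x) (u (Nat.max N N') x))
    <= op_norm (minus (u n) (u (Nat.max N N'))) * norm x) in h1.
  pose proof (norm_minus_triangle (u n x) (u (Nat.max N N') x) (L x)).
  pose proof (Rmult_le_compat_r (norm x) _ _ (norm_ge_0 x) (Rlt_le _ _ HN)); lra. }
assert (Hlin : is_linear L).
{ split.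
  - intros x y; apply norm_minus_small_eq; intros eps heps.
    destruct (HL x (eps / 3)) as [N1 H1]; [lra|].
    destruct (HL y (eps / 3)) as [N2 H2]; [lra|].
    destruct (HL (plus x y) (eps / 3)) as [N3 H3]; [lra|].
    set (n := (N1 + N2 + N3)%nat).
    specialize (H1 n ltac:(lia)); specialize (H2 n ltac:(lia)); specialize (H3 n ltac:(lia)).
    rewrite (linear_plus _ (bl_linear (u n))) in H3.
    pose proof (norm_minus_triangle (L (plus x y)) (plus (u n x) (u n y)) (plus (L x) (L y))) as h.
    rewrite norm_minus_sym in H3.
    pose proof (norm_minus_plus_le (u n x) (u n y) (L x) (L y)); lra.
  - intros k x; apply norm_minus_small_eq; intros eps heps.
    pose proof (Cmod_ge_0 k) as hk.
    destruct (HL x (eps / 2 / (Cmod k + 1))) as [N1 H1]; [apply Rdiv_lt_0_compat; lra|].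
    destruct (HL (scal k x) (eps / 2)) as [N3 H3]; [lra|].
    set (n := (N1 + N3)%nat).
    specialize (H1 n ltac:(lia)); specialize (H3 n ltac:(lia)).
    rewrite (linear_scal _ (bl_linear (u n))) in H3.
    apply (Rmult_lt_compat_r (Cmod k + 1)) in H1; [|lra].
    replace (eps / 2 / (Cmod k + 1) * (Cmod k + 1)) with (eps / 2) in H1 by (field; lra).
    set (a := norm (minus (u n x) (L x))) in *.
    assert (ha : 0 <= a) by apply norm_ge_0.
    apply Rle_trans with (eps / 2 + Cmod k * a); [|lra].
    unfold a; rewrite <- (norm_scal_minus k (u n x) (L x)).
    apply Rle_trans with (1 := norm_minus_triangle _ (scal k (u n x)) _).
    apply Rplus_le_compat_r; rewrite norm_minus_sym; exact (Rlt_le _ _ H3).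
  - destruct (Hclose 1 Rlt_0_1) as [N HN].
    exists (op_norm (u N) + 1); split; [pose proof (op_norm_ge_0 (u N)); lra|].
    intros x; specialize (HN N (le_n N) x).
    pose proof (op_norm_bound (u N) x).
    pose proof (norm_triangle_inv (u N x) (L x)) as h.
    pose proof (Rle_abs (- (norm (u N x) - norm (L x)))) as h2.
    rewrite Rabs_Ropp in h2; lra. }
exists (BoundedLinear L Hlin); intros eps heps.
destruct (Hclose (eps / 2)) as [N HN]; [lra|].
exists N; intros n hn.
apply Rle_lt_trans with (eps / 2); [|lra].
apply op_norm_least; intros x hx.
specialize (HN n hn x).
change (norm (minus (u n x) (L x)) <= eps / 2).
pose proof (norm_ge_0 x); nra.
Qed.

Lemma bounded_below_inverse {V : NormedModule C_AbsRing} (B : bounded_linear V V) (a : R) :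
  0 < a -> (forall x, a * norm x <= norm (B x)) -> (forall y, exists x, B x = y) ->
  exists S : bounded_linear V V, (forall x, S (B x) = x) /\ (forall x, B (S x) = x).
Proof.
intros ha Hlow Hsurj.
destruct (functional_choice _ Hsurj) as [S HS].
assert (Hinj : forall x y, B x = B y -> x = y).
{ intros x y h; apply NNPP; intros hne.
  pose proof (norm_minus_gt_0 x y hne) as hp.
  specialize (Hlow (minus x y)).
  rewrite (linear_minus _ _ _ (bl_linear B)), h, norm_minus_diag in Hlow.
  pose proof (Rmult_lt_0_compat _ _ ha hp); lra. }
assert (Hlin : is_linear S).
{ split.
  - intros x y; apply Hinj; now rewrite (linear_plus _ (bl_linear B)), !HS.
  - intros k x; apply Hinj; now rewrite (linear_scal _ (bl_linear B)), !HS.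
  - exists (/ a); split; [now apply Rinv_0_lt_compat|].
    intros x; specialize (Hlow (S x)); rewrite HS in Hlow.
    apply Rmult_le_reg_l with a; [exact ha|].
    rewrite <- Rmult_assoc, Rinv_r; lra. }
exists (BoundedLinear S Hlin); split; simpl; intros x; [apply Hinj|]; apply HS.
Qed.

Lemma neumann_inverse {V : NormedModule C_AbsRing}
    (HV : complete_dist (fun x y : V => norm (minus x y))) (A : bounded_linear V V) :
  op_norm A < 1 ->
  exists S : bounded_linear V V,
    (forall x, S (minus x (A x)) = x) /\ (forall x, minus (S x) (A (S x)) = x).
Proof.
intros hA; pose proof (op_norm_ge_0 A) as hA0.
assert (HB : is_linear (fun x : V => minus x (A x))).
{ exact (is_linear_comp (fun x => (x, opp (A x))) (fun t => plus (fst t) (snd t))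
   (is_linear_prod _ _ is_linear_id (bl_opp_linear A)) is_linear_plus). }
apply (bounded_below_inverse (BoundedLinear _ HB) (1 - op_norm A)); simpl.
- lra.
- intros x; pose proof (op_norm_bound A x).
  pose proof (norm_triangle_inv x (A x)) as h.
  pose proof (Rle_abs (norm x - norm (A x))); lra.
- intros y.
  set (q := op_norm A) in *.
  set (u := fun n => Nat.iter n (fun x => plus y (A x)) zero).
  assert (Hcontr : forall a b, norm (minus (plus y (A a)) (plus y (A b))) <=
      q * norm (minus a b)).
  { intros a b; apply Rle_trans with (1 := norm_minus_plus_le _ _ _ _).
    rewrite norm_minus_diag, Rplus_0_l, <- (linear_minus _ _ _ (bl_linear A)).
    apply op_norm_bound. }
  set (c := norm y / (1 - q)).
  assert (hc : norm y + q * c = c) by (unfold c; field; lra).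
  assert (hc0 : 0 <= c).
  { pose proof (norm_ge_0 y); unfold c, Rdiv; apply Rmult_le_pos; [lra|].
    apply Rlt_le, Rinv_0_lt_compat; lra. }
  assert (Hbd : forall k, norm (u k) <= c).
  { induction k as [|k IH]; [unfold u; simpl; rewrite norm_zero; exact hc0|].
    apply Rle_trans with (1 := norm_triangle y (A (u k))).
    pose proof (op_norm_bound A (u k)) as h; fold q in h.
    pose proof (Rmult_le_compat_l q _ _ hA0 IH); lra. }
  assert (Hgeo : forall n k, norm (minus (u (n + k)%nat) (u n)) <= q ^ n * c).
  { induction n as [|n IH]; intros k.
    - simpl; rewrite Rmult_1_l.
      exact (eq_ind_r (fun v => norm v <= c) (Hbd k) (minus_zero_r (u k))).
    - apply Rle_trans with (1 := Hcontr (u (n + k)%nat) (u n)).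
      simpl; rewrite Rmult_assoc; apply Rmult_le_compat_l; [exact hA0|apply IH]. }
  destruct (HV u) as [x Hx].
  { intros eps heps.
    destruct (pow_lt_1_zero q) with (y := eps / (2 * (c + 1))) as [N HN].
    - rewrite Rabs_pos_eq; lra.
    - apply Rdiv_lt_0_compat; lra.
    - specialize (HN N (le_n N)).
      rewrite Rabs_pos_eq in HN by (apply pow_le; lra).
      assert (hN : q ^ N * c < eps / 2).
      { apply Rle_lt_trans with (q ^ N * (c + 1)).
        - apply Rmult_le_compat_l; [apply pow_le|]; lra.
        - apply (Rmult_lt_compat_r (c + 1)) in HN; [|lra].
          replace (eps / (2 * (c + 1)) * (c + 1)) with (eps / 2) in HN by (field; lra).
          exact HN. }
      exists N; intros n m hn hm.
      apply Rle_lt_trans with (1 := norm_minus_triangle (u n) (u N) (u m)).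
      rewrite (norm_minus_sym (u N)).
      pose proof (Hgeo N (n - N)%nat) as h1; pose proof (Hgeo N (m - N)%nat) as h2.
      replace (N + (n - N))%nat with n in h1 by lia.
      replace (N + (m - N))%nat with m in h2 by lia; lra. }
  exists x.
  assert (E : x = plus y (A x)).
  { apply norm_minus_small_eq; intros eps heps.
    destruct (Hx (eps / 2)) as [N HN]; [lra|].
    pose proof (HN N (le_n N)) as h1; pose proof (HN (S N) (le_S _ _ (le_n N))) as h2.
    apply Rle_trans with (1 := norm_minus_triangle x (u (S N)) _).
    rewrite norm_minus_sym.
    pose proof (Hcontr (u N) x) as h3.
    pose proof (norm_ge_0 (minus (u N) x)) as h4.
    apply Rle_trans with (eps / 2 + eps / 2); [|lra].
    apply Rplus_le_compat; [exact (Rlt_le _ _ h2)|].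
    apply Rle_trans with (1 := h3).
    apply Rle_trans with (1 * norm (minus (u N) x)); [apply Rmult_le_compat_r; lra|lra]. }
  rewrite E at 1; exact (plus_minus_cancel y (A x)).
Qed.

Lemma resolvent_perturbation {X : NormedModule C_AbsRing}
    (HX : complete_dist (fun x y : X => norm (minus x y))) (T S : bounded_linear X X)
    (l mu : C) :
  (forall x, S (minus (scal mu x) (T x)) = x) ->
  (forall x, minus (scal mu (S x)) (T (S x)) = x) ->
  Cmod (mu - l)%C * op_norm S < 1 -> resolvent_set T l.
Proof.
intros HS1 HS2 hsmall.
destruct (neumann_inverse HX (bl_scal (mu - l)%C S)) as [Q [HQ1 HQ2]].
{ apply Rle_lt_trans with (2 := hsmall), op_norm_scal. }
simpl in HQ1, HQ2.
assert (Hshift : forall x : X, minus (scal l x) (T x) =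
    minus (minus (scal mu x) (T x)) (scal (mu - l)%C x)).
{ intros x; exact (scal_minus_shift l mu x (T x)). }
exists (BoundedLinear _ (is_linear_comp _ _ (bl_linear Q) (bl_linear S))); simpl; split; intros x.
- rewrite Hshift; set (w := minus (scal mu x) (T x)).
  replace x with (S w) by apply HS1.
  rewrite HQ1; reflexivity.
- rewrite Hshift, HS2; apply HQ2.
Qed.

Lemma resolvent_of_large {X : NormedModule C_AbsRing}
    (HX : complete_dist (fun x y : X => norm (minus x y))) (T : bounded_linear X X) (l : C) :
  op_norm T < Cmod l -> resolvent_set T l.
Proof.
intros hl; pose proof (op_norm_ge_0 T) as hT.
assert (hl0 : l <> 0%C) by (intros ->; rewrite Cmod_0 in hl; lra).
destruct (neumann_inverse HX (bl_scal (/ l)%C T)) as [Q [HQ1 HQ2]].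
{ apply Rle_lt_trans with (1 := op_norm_scal _ _).
  rewrite Cmod_inv by exact hl0.
  apply Rmult_lt_reg_l with (Cmod l); [lra|].
  rewrite <- Rmult_assoc, Rinv_r; lra. }
simpl in HQ1, HQ2.
assert (Hfac : forall x : X, minus (scal l x) (T x) = scal l (minus x (scal (/ l)%C (T x)))).
{ intros x; exact (scal_minus_factor l x (T x) hl0). }
exists (BoundedLinear _ (is_linear_comp _ _ (is_linear_scal_r (/ l)%C Cmult_comm) (bl_linear Q))).
simpl; split; intros x; rewrite Hfac.
- transitivity (Q (minus x (scal (/ l)%C (T x)))); [f_equal|apply HQ1].
  exact (scal_inv_l l _ hl0).
- rewrite HQ2; exact (scal_inv_r l _ hl0).
Qed.

Lemma approximate_eigenvector {X : NormedModule C_AbsRing}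
    (HX : complete_dist (fun x y : X => norm (minus x y))) (T : bounded_linear X X) (r : R) :
  spectral_radius T = Finite r -> 0 <= r ->
  forall eps, 0 < eps -> exists (mu : C) (x : X),
    r < Cmod mu /\ norm x = 1 /\ norm (minus (T x) (scal mu x)) <= eps.
Proof.
intros hr hr0 eps heps.
pose proof (Lub_Rbar_correct (fun s => exists l : C, spectrum T l /\ s = Cmod l)) as [Hub Hleast].
fold (spectral_radius T) in Hub, Hleast; rewrite hr in Hub, Hleast.
set (d := eps / 4).
assert (hd : 0 < d) by (unfold d; lra).
assert (Hl : exists l, spectrum T l /\ r - d < Cmod l).
{ apply NNPP; intros H.
  assert (h : Rbar_le r (r - d)).
  { apply Hleast; intros s [l [hl ->]]; simpl.
    apply Rnot_lt_le; intros h; apply H; now exists l. }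
  simpl in h; lra. }
destruct Hl as [l [hl hlr]].
assert (hlr2 : Cmod l <= r) by (apply (Hub (Cmod l)); now exists l).
assert (Hmu : exists mu : C, r < Cmod mu /\ Cmod (mu - l)%C <= 2 * d).
{ destruct (Ceq_dec l 0) as [->|hl0].
  - exists (RtoC (2 * d)).
    replace (RtoC (2 * d) - 0)%C with (RtoC (2 * d)) by ring.
    rewrite Cmod_0 in hlr; rewrite Cmod_R, Rabs_pos_eq; lra.
  - assert (hp : 0 < Cmod l) by now apply Cmod_gt_0.
    assert (ht : 0 < 2 * d / Cmod l) by (apply Rdiv_lt_0_compat; lra).
    exists (l * RtoC (1 + 2 * d / Cmod l))%C.
    replace (l * RtoC (1 + 2 * d / Cmod l) - l)%C with (l * RtoC (2 * d / Cmod l))%C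
      by (rewrite RtoC_plus; ring).
    rewrite !Cmod_mult, !Cmod_R, !Rabs_pos_eq by lra.
    replace (Cmod l * (1 + 2 * d / Cmod l)) with (Cmod l + 2 * d) by (field; lra).
    replace (Cmod l * (2 * d / Cmod l)) with (2 * d) by (field; lra); lra. }
destruct Hmu as [mu [hmu hmul]].
assert (Hres : resolvent_set T mu).
{ apply NNPP; intros h.
  pose proof (Hub (Cmod mu) (ex_intro _ mu (conj h eq_refl))) as h2; simpl in h2; lra. }
destruct Hres as [S [HS1 HS2]].
assert (Hbig : 1 <= Cmod (mu - l)%C * op_norm S).
{ apply Rnot_lt_le; intros h; apply hl.
  exact (resolvent_perturbation HX T S l mu HS1 HS2 h). }
assert (HSbig : / eps < op_norm S).
{ pose proof (op_norm_ge_0 S).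
  assert (h : 1 <= 2 * d * op_norm S).
  { apply Rle_trans with (1 := Hbig); apply Rmult_le_compat_r; lra. }
  apply Rmult_lt_reg_l with eps; [exact heps|].
  rewrite Rinv_r; unfold d in h; lra. }
assert (Hy : exists y : X, norm y <= 1 /\ / eps < norm (S y)).
{ apply NNPP; intros H; apply (Rlt_not_le _ _ HSbig).
  apply op_norm_least; intros y hy; apply Rnot_lt_le; intros h; apply H; now exists y. }
destruct Hy as [y [hy1 hy2]].
assert (hS0 : 0 < norm (S y)).
{ apply Rlt_trans with (2 := hy2), Rinv_0_lt_compat, heps. }
set (k := RtoC (/ norm (S y))).
assert (hk : Cmod k = / norm (S y)).
{ unfold k; rewrite Cmod_R, Rabs_pos_eq; [reflexivity|].
  apply Rlt_le, Rinv_0_lt_compat, hS0. }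
exists mu, (scal k (S y)); split; [exact hmu|split].
- rewrite norm_scal_C, hk; apply Rinv_l; lra.
- rewrite norm_minus_sym.
  assert (E : norm (minus (scal mu (scal k (S y))) (T (scal k (S y)))) = norm (scal k y)).
  { f_equal; rewrite (linear_scal _ (bl_linear T)).
    transitivity (scal k (minus (scal mu (S y)) (T (S y)))); [|now rewrite HS2].
    exact (scal_comm_minus k mu (S y) (T (S y))). }
  apply Rle_trans with (1 := Req_le _ _ E); rewrite norm_scal_C, hk.
  apply Rmult_le_reg_l with (norm (S y)); [exact hS0|].
  rewrite <- Rmult_assoc, Rinv_r, Rmult_1_l by lra.
  apply Rle_trans with (1 := hy1).
  apply Rlt_le, Rmult_lt_reg_r with (/ eps); [now apply Rinv_0_lt_compat|].
  rewrite Rmult_assoc, Rinv_r; lra.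
Qed.

(** * Weak orbits *)

Lemma complete_dist_prod {P Q : Type} (d : P -> P -> R) (d' : Q -> Q -> R)
  (d_ge_0 : forall p q, 0 <= d p q) (d'_ge_0 : forall p q, 0 <= d' p q) :
  complete_dist d -> complete_dist d' ->
  complete_dist (fun p q : P * Q => d (fst p) (fst q) + d' (snd p) (snd q)).
Proof.
intros hd hd' u Hu; cbv beta in Hu.
destruct (hd (fun n => fst (u n))) as [l Hl].
{ intros eps heps; destruct (Hu eps heps) as [N HN]; exists N; intros n m hn hm.
  specialize (HN n m hn hm); pose proof (d'_ge_0 (snd (u n)) (snd (u m))); lra. }
destruct (hd' (fun n => snd (u n))) as [l' Hl'].
{ intros eps heps; destruct (Hu eps heps) as [N HN]; exists N; intros n m hn hm.
  specialize (HN n m hn hm); pose proof (d_ge_0 (fst (u n)) (fst (u m))); lra. }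
exists (l, l'); intros eps heps; simpl.
destruct (Hl (eps / 2)) as [N HN]; [lra|].
destruct (Hl' (eps / 2)) as [N' HN']; [lra|].
exists (N + N')%nat; intros n hn.
specialize (HN n ltac:(lia)); specialize (HN' n ltac:(lia)); lra.
Qed.

Lemma complete_dist_sig {P : Type} (d : P -> P -> R) (F : P -> Prop)
  (F_closed : forall l, (forall eps, 0 < eps -> exists p, F p /\ d p l < eps) -> F l) :
  complete_dist d ->
  complete_dist (fun p q : {x : P | F x} => d (proj1_sig p) (proj1_sig q)).
Proof.
intros hd u Hu.
destruct (hd (fun n => proj1_sig (u n)) Hu) as [l Hl].
assert (hl : F l).
{ apply F_closed; intros eps heps; destruct (Hl eps heps) as [N HN].
  exists (proj1_sig (u N)); split; [exact (proj2_sig (u N))|exact (HN N (le_n N))]. }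
exists (exist _ l hl); exact Hl.
Qed.

Lemma norm_minus_plus_r {K : AbsRing} {V : NormedModule K} (x y : V) :
  norm (minus x (plus x y)) = norm y.
Proof.
rewrite norm_minus_sym; f_equal.
exact (eq_trans (f_equal (fun v => minus v x) (plus_comm x y)) (plus_minus_cancel y x)).
Qed.

Lemma pairing_continuous {X : NormedModule C_AbsRing} (T : bounded_linear X X) (N : nat)
    (x : X) (x' : dual X) (eta : R) : 0 < eta ->
  exists e, 0 < e /\ forall (y : X) (y' : dual X),
    norm (minus x y) + op_norm (minus x' y') < e ->
    forall n, (n < N)%nat ->
    Cmod (x' (Nat.iter n T x) - y' (Nat.iter n T y))%C < eta.
Proof.
intros heta.
set (K := 1 + op_norm T).
pose proof (op_norm_ge_0 T) as hT; pose proof (norm_ge_0 x) as hx.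
pose proof (op_norm_ge_0 x') as hx'.
assert (hKN : 0 < K ^ N) by (apply pow_lt; unfold K; lra).
set (A := K ^ N * (op_norm x' + norm x + 1)).
assert (hA : 0 < A) by (apply Rmult_lt_0_compat; lra).
exists (Rmin 1 (eta / A)); split.
{ apply Rmin_pos; [lra|now apply Rdiv_lt_0_compat]. }
intros y y' hd n hn.
set (a := norm (minus x y)) in *; set (b := op_norm (minus x' y')) in *.
assert (ha : 0 <= a) by apply norm_ge_0.
assert (hb : 0 <= b) by apply op_norm_ge_0.
pose proof (Rmin_l 1 (eta / A)); pose proof (Rmin_r 1 (eta / A)).
assert (Hiter : forall z : X, norm (Nat.iter n T z) <= K ^ N * norm z).
{ intros z; apply Rle_trans with (1 := norm_iter_le T n z).
  apply Rmult_le_compat_r; [apply norm_ge_0|].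
  apply Rle_trans with (K ^ n).
  - apply pow_incr; unfold K; lra.
  - apply Rle_pow; [unfold K; lra|lia]. }
assert (hy : norm y <= norm x + 1).
{ pose proof (norm_triangle_inv x y) as h; fold a in h.
  pose proof (Rle_abs (- (norm x - norm y))) as h2; rewrite Rabs_Ropp in h2; lra. }
assert (h1 : Cmod (x' (Nat.iter n T x) - x' (Nat.iter n T y))%C <= op_norm x' * (K ^ N * a)).
{ replace (x' (Nat.iter n T x) - x' (Nat.iter n T y))%C
    with (x' (Nat.iter n T (minus x y))).
  - apply Rle_trans with (1 := op_norm_bound x' _).
    apply Rmult_le_compat_l; [exact hx'|apply Hiter].
  - rewrite (linear_minus _ _ _ (is_linear_iter T n)), (linear_minus _ _ _ (bl_linear x')).
    reflexivity. }
assert (h2 : Cmod (x' (Nat.iter n T y) - y' (Nat.iter n T y))%C <= b * (K ^ N * (norm x + 1))).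
{ apply Rle_trans with (1 := op_norm_bound (minus x' y') (Nat.iter n T y)).
  apply Rmult_le_compat_l; [exact hb|].
  apply Rle_trans with (1 := Hiter y), Rmult_le_compat_l; lra. }
replace (x' (Nat.iter n T x) - y' (Nat.iter n T y))%C with
  ((x' (Nat.iter n T x) - x' (Nat.iter n T y)) + (x' (Nat.iter n T y) - y' (Nat.iter n T y)))%C
  by ring.
apply Rle_lt_trans with (1 := Cmod_triangle _ _).
apply Rle_lt_trans with ((a + b) * A).
- assert (0 <= op_norm x' * (K ^ N * b)) by (repeat apply Rmult_le_pos; lra).
  assert (0 <= a * (K ^ N * (norm x + 1))) by (repeat apply Rmult_le_pos; lra).
  unfold A; lra.
- apply Rlt_le_trans with (eta / A * A); [apply Rmult_lt_compat_r; lra|].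
  right; field; lra.
Qed.

Lemma sum_n_le_series (a : nat -> R) (l : R) :
  (forall n, 0 <= a n) -> is_series a l -> forall N, sum_n a N <= l.
Proof.
intros ha hl N.
apply (is_lim_seq_incr_compare (sum_n a) l); [exact hl|].
intros n; rewrite sum_Sn; change (sum_n a n <= sum_n a n + a (S n)).
specialize (ha (S n)); lra.
Qed.

Lemma pairing_polarization {X : NormedModule C_AbsRing} (T : bounded_linear X X) (n : nat)
    (x0 x : X) (x0' x' : dual X) (s : C) :
  (s * s * x' (Nat.iter n T x) =
    (plus x0' (scal s x') : dual X) (Nat.iter n T (plus x0 (scal s x)))
    - x0' (Nat.iter n T (plus x0 (scal s x)))
    - (plus x0' (scal s x') : dual X) (Nat.iter n T x0)
    + x0' (Nat.iter n T x0))%C.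
Proof.
rewrite (linear_plus _ (is_linear_iter T n)), (linear_scal _ (is_linear_iter T n)).
rewrite !(linear_plus _ (bl_linear _)), !(linear_scal _ (bl_linear _)).
change (bl_fun (plus x0' (scal s x'))) with (fun z => (x0' z + s * x' z)%C).
set (a := x0' (Nat.iter n T x)); set (b := x' (Nat.iter n T x)).
set (c := x0' (Nat.iter n T x0)); set (e := x' (Nat.iter n T x0)).
change (s * s * b = (c + s * e) + s * (a + s * b) - (c + s * a) - (c + s * e) + c)%C.
ring.
Qed.

Lemma iterates_near_eigenvector {X : NormedModule C_AbsRing} (T : bounded_linear X X)
    (mu : C) (x : X) (K eps : R) :
  1 <= K -> op_norm T <= K -> Cmod mu <= K -> norm (minus (T x) (scal mu x)) <= eps ->
  forall n, exists c, Cmod c = Cmod mu ^ n /\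
    norm (minus (Nat.iter n T x) (scal c x)) <= INR n * K ^ n * eps.
Proof.
intros hK hT hmu heps.
pose proof (op_norm_ge_0 T) as hT0; pose proof (norm_ge_0 (minus (T x) (scal mu x))) as h0.
induction n as [|n [c [hc IH]]].
- exists (RtoC 1); rewrite Cmod_1; split; [reflexivity|].
  simpl; apply Req_le; rewrite !Rmult_0_l.
  transitivity (norm (minus x x)); [|apply norm_minus_diag].
  f_equal; f_equal; exact (scal_one (K := C_Ring) x).
- exists (c * mu)%C; split; [rewrite Cmod_mult, hc; simpl; ring|].
  apply Rle_trans with (norm (minus (T (Nat.iter n T x)) (T (scal c x)))
    + norm (minus (scal c (T x)) (scal c (scal mu x)))).
  { apply Rle_trans with (1 := norm_minus_triangle _ (T (scal c x)) _).
    apply Rplus_le_compat_l, Req_le.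
    rewrite (linear_scal _ (bl_linear T)); f_equal; f_equal.
    symmetry; exact (scal_assoc (K := C_Ring) c mu x). }
  rewrite norm_scal_minus, <- (linear_minus _ _ _ (bl_linear T)), S_INR, hc.
  pose proof (pow_le K n ltac:(lra)) as hKn.
  assert (hmun : Cmod mu ^ n <= K ^ n) by (apply pow_incr; split; [apply Cmod_ge_0|exact hmu]).
  pose proof (pow_le (Cmod mu) n (Cmod_ge_0 mu)) as hmu0.
  pose proof (pos_INR n) as hn.
  apply Rle_trans with (K * (INR n * K ^ n * eps) + K ^ n * eps).
  + apply Rplus_le_compat.
    * apply Rle_trans with (1 := op_norm_bound T _).
      apply Rmult_le_compat; [lra|apply norm_ge_0|lra|exact IH].
    * apply Rmult_le_compat; lra.
  + assert (0 <= K ^ n * eps) by (apply Rmult_le_pos; lra).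
    simpl; nra.
Qed.

Lemma weak_orbits_uniformly_small {X : NormedModule C_AbsRing}
    (HX : complete_dist (fun x y : X => norm (minus x y)))
    (E : dual X -> Prop) (hEsub : is_subspace E) (hEclosed : closed E)
    (T : bounded_linear X X) (Phi : (R -> R) -> Prop) (hPhi : at_most_countable Phi)
    (hPhi_fun : forall phi, Phi phi ->
       nonneg_valued phi /\ nondecreasing phi /\ strictly_positive phi)
    (hsum : forall (x : X) (x' : dual X), E x' -> norm x <= 1 -> norm x' <= 1 ->
       exists phi, Phi phi /\ ex_series (fun n => phi (Cmod (x' (Nat.iter n T x)))))
    (kappa : R) : 0 < kappa ->
  exists N, forall (x : X) (x' : dual X), E x' -> norm x <= 1 -> norm x' <= 1 ->
    exists n, (n < N)%nat /\ Cmod (x' (Nat.iter n T x)) < kappa.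
Proof.
intros hkappa.
destruct hPhi as [f hf]; destruct hEsub as [hE0 [hEplus hEscal]].
set (P := {p : X * dual X | E (snd p)}).
set (d := fun p q : X * dual X =>
  norm (minus (fst p) (fst q)) + op_norm (minus (snd p) (snd q))).
set (b := fun n (p : P) =>
  Cmod (snd (proj1_sig p) (Nat.iter n T (fst (proj1_sig p))))).
(* [k] codes an element of [Phi] together with a natural number that serves both as the bound on
   the series and as a scaling, the latter because the hypothesis only covers the unit balls. *)
set (G := fun k (p : P) => exists phi, Phi phi /\ f phi = fst (Cantor.of_nat k) /\
  forall N, sum_n (fun n => phi (b n p / (INR (snd (Cantor.of_nat k)) + 1))) N
    <= INR (snd (Cantor.of_nat k)) + 1).
assert (dual_sym : forall u v : dual X, op_norm (minus u v) = op_norm (minus v u)).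
{ exact (norm_minus_sym (V := @bl_NormedModule X C_NormedModule)). }
assert (dual_diag : forall u : dual X, op_norm (minus u u) = 0).
{ exact (norm_minus_diag (V := @bl_NormedModule X C_NormedModule)). }
assert (d_refl : forall p, d p p = 0).
{ intros [x x']; unfold d; simpl; rewrite norm_minus_diag, dual_diag; lra. }
destruct (baire_somewhere_dense (fun p q : P => d (proj1_sig p) (proj1_sig q)))
  with (G := G) as [k [p [e [he Hdense]]]].
- intros p; apply d_refl.
- intros [[x x'] h] [[y y'] h2]; unfold d; simpl.
  now rewrite norm_minus_sym, dual_sym.
- intros [[x x'] h1] [[y y'] h2] [[z z'] h3]; unfold d; simpl.
  pose proof (norm_minus_triangle x y z).
  pose proof (norm_minus_triangle (V := @bl_NormedModule X C_NormedModule) x' y' z') as h4.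
  change (op_norm (minus x' z') <= op_norm (minus x' y') + op_norm (minus y' z')) in h4; lra.
- apply (complete_dist_sig d (fun p => E (snd p))).
  + intros [l l'] Hl; simpl; apply hEclosed; intros [eps Heps].
    destruct (Hl eps (cond_pos eps)) as [[y y'] [hy hd]]; simpl in hy.
    apply (Heps y'); [|exact hy].
    unfold d in hd; simpl in hd; pose proof (norm_ge_0 (minus y l)).
    change (op_norm (minus y' l') < eps); lra.
  + apply (complete_dist_prod (fun x y : X => norm (minus x y))
      (fun u v : dual X => op_norm (minus u v))); [| |exact HX|].
    * intros; apply norm_ge_0.
    * intros; apply op_norm_ge_0.
    * apply complete_op_norm; exact (complete_norm C_CompleteNormedModule).
- intros [[x x'] hx'].
  pose proof (norm_ge_0 x) as h1; pose proof (op_norm_ge_0 x') as h2.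
  set (a := 1 + norm x + op_norm x').
  assert (ha : 1 <= a) by (unfold a; lra).
  set (s := RtoC (/ a)).
  assert (hs : Cmod s = / a).
  { unfold s; rewrite Cmod_R, Rabs_pos_eq; [reflexivity|].
    apply Rlt_le, Rinv_0_lt_compat; lra. }
  destruct (hsum (scal s x) (scal s x')) as [phi [hphi [L HL]]].
  + apply hEscal; exact hx'.
  + rewrite norm_scal_C, hs; apply Rmult_le_reg_l with a; [lra|].
    rewrite <- Rmult_assoc, Rinv_r; unfold a; lra.
  + apply Rle_trans with (1 := op_norm_scal s x'); rewrite hs.
    apply Rmult_le_reg_l with a; [lra|].
    rewrite <- Rmult_assoc, Rinv_r; unfold a; lra.
  + destruct (hPhi_fun phi hphi) as [hnn [hmono _]].
    destruct (INR_unbounded (a * a + Rabs L)) as [m hm].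
    assert (haa : 0 < a * a) by nra.
    pose proof (Rabs_pos L) as hL.
    exists (Cantor.to_nat (f phi, m)), phi.
    rewrite Cantor.cancel_of_to; simpl; split; [exact hphi|split; [reflexivity|intros N]].
    apply Rle_trans with L; [|pose proof (Rle_abs L); lra].
    apply Rle_trans with
      (sum_n (fun n => phi (Cmod ((scal s x' : dual X) (Nat.iter n T (scal s x))))) N).
    * apply sum_n_m_le; intros n.
      assert (hb : Cmod ((scal s x' : dual X) (Nat.iter n T (scal s x))) =
                   Cmod (x' (Nat.iter n T x)) / (a * a)).
      { rewrite (linear_scal _ (is_linear_iter T n)), (linear_scal _ (bl_linear _)).
        change (Cmod (s * (s * x' (Nat.iter n T x)))%C = Cmod (x' (Nat.iter n T x)) / (a * a)).
        rewrite !Cmod_mult, hs; field; lra. }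
      rewrite hb; unfold b; simpl.
      pose proof (Cmod_ge_0 (x' (Nat.iter n T x))) as h3.
      apply hmono; unfold Rdiv.
      { apply Rmult_le_pos; [exact h3|apply Rlt_le, Rinv_0_lt_compat; lra]. }
      apply Rmult_le_compat_l; [exact h3|apply Rinv_le_contravar; lra].
    * apply sum_n_le_series; [|exact HL].
      intros n; apply hnn, Cmod_ge_0.
- exists (zero, zero); exact hE0.
- destruct p as [[x0 x0'] hx0'].
  set (M := INR (snd (Cantor.of_nat k)) + 1) in *.
  assert (hM : 0 < M) by (unfold M; pose proof (pos_INR (snd (Cantor.of_nat k))); lra).
  assert (Hphi : exists phi, Phi phi /\ f phi = fst (Cantor.of_nat k)).
  { destruct (Hdense (exist _ (x0, x0') hx0')) with (eta := 1) as [z [[phi [h1 [h2 _]]] _]].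
    - simpl; rewrite d_refl; exact he.
    - lra.
    - now exists phi. }
  destruct Hphi as [phi [hphi hfphi]].
  assert (HG : forall z, G k z -> forall N, sum_n (fun n => phi (b n z / M)) N <= M).
  { intros z [psi [h1 [h2 h3]]].
    rewrite (hf phi psi hphi h1 (eq_trans hfphi (eq_sym h2))); exact h3. }
  destruct (hPhi_fun phi hphi) as [hnn [hmono hpos]].
  set (s := e / 4).
  set (t := s * s * kappa / 8).
  assert (hs : 0 < s) by (unfold s; lra).
  assert (ht : 0 < t) by (unfold t; repeat apply Rdiv_lt_0_compat; try lra;
    repeat apply Rmult_lt_0_compat; lra).
  assert (hphit : 0 < phi (t / M)) by (apply hpos, Rdiv_lt_0_compat; lra).
  destruct (INR_unbounded (4 * M / phi (t / M))) as [N HN].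
  exists (S N); intros x x' hx' hnx hnx'.
  apply NNPP; intros Hn.
  assert (Hbig : forall n, (n < S N)%nat -> kappa <= Cmod (x' (Nat.iter n T x))).
  { intros n hn; apply Rnot_lt_le; intros h; apply Hn; now exists n. }
  assert (hsx : norm (scal (RtoC s) x) <= s).
  { rewrite norm_scal_C, Cmod_R, Rabs_pos_eq by lra; nra. }
  assert (hsx' : op_norm (scal (RtoC s) x') <= s).
  { apply Rle_trans with (1 := op_norm_scal (RtoC s) x').
    rewrite Cmod_R, Rabs_pos_eq by lra.
    change (op_norm x' <= 1) in hnx'; nra. }
  assert (Happrox : forall (y : X) (y' : dual X), E y' -> d (x0, x0') (y, y') < e ->
    exists z, G k z /\ forall n, (n < S N)%nat ->
      Cmod (y' (Nat.iter n T y)) <= b n z + t).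
  { intros y y' hy' hd.
    destruct (pairing_continuous T (S N) y y' t ht) as [eta [heta Hcont]].
    destruct (Hdense (exist _ (y, y') hy') hd eta heta) as [[[z z'] hz'] [hz1 hz2]].
    exists (exist _ (z, z') hz'); split; [exact hz1|intros n hn].
    specialize (Hcont z z' hz2 n hn); unfold b; simpl.
    set (u := y' (Nat.iter n T y)) in *; set (v := z' (Nat.iter n T z)) in *.
    replace u with (v + (u - v))%C by ring.
    apply Rle_trans with (1 := Cmod_triangle _ _); lra. }
  assert (h1 : norm (minus x0 (plus x0 (scal (RtoC s) x))) <= s).
  { apply Rle_trans with (2 := hsx), Req_le, norm_minus_plus_r. }
  assert (h2 : op_norm (minus x0' (plus x0' (scal (RtoC s) x'))) <= s).
  { apply Rle_trans with (2 := hsx'), Req_le.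
    exact (norm_minus_plus_r (V := @bl_NormedModule X C_NormedModule) x0' (scal (RtoC s) x')). }
  assert (h3 := norm_minus_diag x0); assert (h4 := dual_diag x0').
  assert (hy' : E (plus x0' (scal (RtoC s) x'))) by (apply hEplus; [|apply hEscal]; assumption).
  destruct (Happrox (plus x0 (scal (RtoC s) x)) (plus x0' (scal (RtoC s) x')))
    as [z1 [hz1 H1]]; [exact hy'|unfold d, s in *; simpl; lra|].
  destruct (Happrox (plus x0 (scal (RtoC s) x)) x0')
    as [z2 [hz2 H2]]; [exact hx0'|unfold d, s in *; simpl; lra|].
  destruct (Happrox x0 (plus x0' (scal (RtoC s) x')))
    as [z3 [hz3 H3]]; [exact hy'|unfold d, s in *; simpl; lra|].
  destruct (Happrox x0 x0') as [z4 [hz4 H4]]; [exact hx0'|rewrite d_refl; exact he|].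
  assert (hterm : forall n z, 0 <= phi (b n z / M)).
  { intros n z; apply hnn, Rmult_le_pos; [apply Cmod_ge_0|].
    apply Rlt_le, Rinv_0_lt_compat, hM. }
  assert (Hpt : forall n, (n < S N)%nat -> phi (t / M) <=
    phi (b n z1 / M) + phi (b n z2 / M) + phi (b n z3 / M) + phi (b n z4 / M)).
  { intros n hn.
    specialize (H1 n hn); specialize (H2 n hn); specialize (H3 n hn); specialize (H4 n hn).
    assert (hsum4 : 8 * t <= (b n z1 + t) + (b n z2 + t) + (b n z3 + t) + (b n z4 + t)).
    { apply Rle_trans with (Cmod (RtoC s * RtoC s * x' (Nat.iter n T x))%C).
      - rewrite !Cmod_mult, !Cmod_R, !Rabs_pos_eq by lra.
        unfold t; specialize (Hbig n hn).
        apply Rle_trans with (s * s * kappa); [right; field|].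
        apply Rmult_le_compat_l; [nra|exact Hbig].
      - rewrite (pairing_polarization T n x0 x x0' x' (RtoC s)).
        apply Rle_trans with (1 := Cmod_triangle _ _), Rplus_le_compat; [|exact H4].
        unfold Cminus.
        apply Rle_trans with (1 := Cmod_triangle _ _), Rplus_le_compat;
          [|rewrite Cmod_opp; exact H3].
        apply Rle_trans with (1 := Cmod_triangle _ _), Rplus_le_compat;
          [exact H1|rewrite Cmod_opp; exact H2]. }
    assert (hmon : forall z, t <= b n z -> phi (t / M) <= phi (b n z / M)).
    { intros z hz; apply hmono; unfold Rdiv.
      - apply Rmult_le_pos; [lra|apply Rlt_le, Rinv_0_lt_compat, hM].
      - apply Rmult_le_compat_r; [apply Rlt_le, Rinv_0_lt_compat, hM|exact hz]. }
    pose proof (hterm n z1); pose proof (hterm n z2).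
    pose proof (hterm n z3); pose proof (hterm n z4).
    destruct (Rle_dec t (b n z1)) as [h|g1]; [specialize (hmon _ h); lra|].
    destruct (Rle_dec t (b n z2)) as [h|g2]; [specialize (hmon _ h); lra|].
    destruct (Rle_dec t (b n z3)) as [h|g3]; [specialize (hmon _ h); lra|].
    apply Rle_trans with (phi (b n z4 / M)); [apply hmon|]; lra. }
  set (sigma := fun z => sum_n (fun n => phi (b n z / M))).
  assert (Hsum : forall m, (m <= N)%nat -> INR (S m) * phi (t / M) <=
    sigma z1 m + sigma z2 m + sigma z3 m + sigma z4 m).
  { unfold sigma; induction m as [|m IH]; intros hm.
    - rewrite !sum_O, Rmult_1_l; apply Hpt; lia.
    - rewrite !sum_Sn, S_INR; specialize (IH ltac:(lia)); specialize (Hpt (S m) ltac:(lia)).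
      change plus with Rplus; lra. }
  specialize (Hsum N (le_n N)).
  pose proof (HG z1 hz1 N : sigma z1 N <= M); pose proof (HG z2 hz2 N : sigma z2 N <= M).
  pose proof (HG z3 hz3 N : sigma z3 N <= M); pose proof (HG z4 hz4 N : sigma z4 N <= M).
  apply (Rmult_lt_compat_r (phi (t / M))) in HN; [|exact hphit].
  replace (4 * M / phi (t / M) * phi (t / M)) with (4 * M) in HN by (field; lra).
  rewrite S_INR in Hsum; lra.
Qed.

Theorem theorem4p2 (X : CompleteNormedModule C_AbsRing)
  (E : dual X -> Prop)
  (hEsub : is_subspace E) (hEclosed : closed E) (hEnorming : almost_norming E)
  (T : bounded_linear X X)
  (Phi : (R -> R) -> Prop) (hPhi : at_most_countable Phi)
  (hPhi_fun : forall phi, Phi phi ->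
     nonneg_valued phi /\ nondecreasing phi /\ strictly_positive phi)
  (hsum : forall (x : X) (x' : dual X), E x' -> norm x <= 1 -> norm x' <= 1 ->
     exists phi, Phi phi /\
       ex_series (fun n : nat => phi (Cmod (x' (Nat.iter n T x))))) :
  Rbar_lt (spectral_radius T) 1.
Proof.
pose proof (complete_norm X) as HX.
apply Rbar_not_le_lt; intros h1.
assert (hfin : Rbar_le (spectral_radius T) (op_norm T)).
{ apply (proj2 (Lub_Rbar_correct _)); intros s [l [hl ->]]; simpl.
  apply Rnot_lt_le; intros h; apply hl; exact (resolvent_of_large HX T l h). }
destruct (spectral_radius T) as [r| |] eqn:hr; simpl in h1, hfin; try contradiction.
destruct hEnorming as [c [hc Hnorming]].
set (kappa := / (4 * c)).
assert (hkappa : 0 < kappa) by (apply Rinv_0_lt_compat; lra).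
destruct (weak_orbits_uniformly_small HX E hEsub hEclosed T Phi hPhi hPhi_fun hsum kappa hkappa)
  as [N HN].
pose proof (op_norm_ge_0 T) as hT.
set (K := 1 + op_norm T).
assert (hK : 1 <= K) by (unfold K; lra).
assert (hKN : 0 <= INR N * K ^ N) by (apply Rmult_le_pos; [apply pos_INR|apply pow_le; lra]).
set (eps := Rmin 1 (kappa / (INR N * K ^ N + 1))).
assert (heps : 0 < eps).
{ apply Rmin_pos; [lra|apply Rdiv_lt_0_compat; lra]. }
assert (heps1 : eps <= 1) by apply Rmin_l.
assert (heps2 : INR N * K ^ N * eps <= kappa).
{ apply Rle_trans with ((INR N * K ^ N + 1) * (kappa / (INR N * K ^ N + 1))).
  - apply Rmult_le_compat; [exact hKN|lra|lra|apply Rmin_r].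
  - right; field; lra. }
destruct (approximate_eigenvector HX T r hr ltac:(lra) eps heps) as [mu [x [hmu [hx hTx]]]].
assert (hmuK : Cmod mu <= K).
{ pose proof (op_norm_bound T x) as h2; rewrite hx in h2.
  pose proof (norm_triangle_inv (scal mu x) (T x)) as h3.
  rewrite norm_minus_sym in h3.
  pose proof (Rle_abs (norm (scal mu x) - norm (T x))) as h4.
  rewrite (norm_scal_C mu x), hx in h3, h4; unfold K; lra. }
assert (Hx' : exists x' : dual X, E x' /\ norm x' <= 1 /\ 2 * kappa < Cmod (x' x)).
{ apply NNPP; intros H.
  assert (h : Rbar_le (norm x) (1 / 2)).
  { apply Rbar_le_trans with (1 := Hnorming x).
    apply (proj2 (Lub_Rbar_correct _)); intros s [x' [h2 [h3 ->]]]; simpl.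
    apply Rnot_lt_le; intros h4; apply H; exists x'; split; [exact h2|split; [exact h3|]].
    apply Rmult_lt_reg_l with c; [exact hc|].
    apply Rle_lt_trans with (2 := h4); unfold kappa; right; field; lra. }
  simpl in h; lra. }
destruct Hx' as [x' [hx'E [hx'1 hx'x]]].
destruct (HN x x' hx'E (Req_le _ _ hx) hx'1) as [n [hn hsmall]].
destruct (iterates_near_eigenvector T mu x K eps hK ltac:(unfold K; lra) hmuK hTx n)
  as [a [ha Hnear]].
assert (hamp : 1 <= Cmod a) by (rewrite ha; apply pow_R1_Rle; lra).
assert (herr : INR n * K ^ n * eps <= kappa).
{ apply Rle_trans with (2 := heps2), Rmult_le_compat_r; [lra|].
  apply Rmult_le_compat; [apply pos_INR|apply pow_le; lra| |].
  - apply le_INR; lia.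
  - apply Rle_pow; [exact hK|lia]. }
assert (hdiff : Cmod (a * x' x - x' (Nat.iter n T x))%C <= kappa).
{ apply Rle_trans with (norm (x' (minus (scal a x) (Nat.iter n T x)))).
  - apply Req_le; rewrite (linear_minus _ _ _ (bl_linear x')), (linear_scal _ (bl_linear x')).
    reflexivity.
  - apply Rle_trans with (1 := op_norm_bound x' _).
    apply Rle_trans with (1 * kappa); [|lra].
    apply Rmult_le_compat; [apply op_norm_ge_0|apply norm_ge_0|exact hx'1|].
    apply Rle_trans with (2 := herr), Rle_trans with (2 := Hnear), Req_le.
    apply (norm_minus_sym (V := X)). }
pose proof (Cmod_triangle (a * x' x - x' (Nat.iter n T x))%C (x' (Nat.iter n T x))) as htri.
replace (a * x' x - x' (Nat.iter n T x) + x' (Nat.iter n T x))%C with (a * x' x)%C in htri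
  by ring.
rewrite Cmod_mult in htri.
pose proof (Rmult_le_compat_r (Cmod (x' x)) _ _ (Cmod_ge_0 _) hamp); lra.
Qed.
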